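(* Let $(J,\mathcal{B})$ be a standard Borel space, let $\alpha,\beta\in\mathcal{M}(\mathcal{B}^2)$ with $\alpha\le\beta$, and let $\varphi\colon\mathcal{B}\to\mathbb{R}$ be a bounded continuous submodular set function with $\varphi(\emptyset)=\varphi(J)=0$. Then there exists $\mu\in\mathcal{M}(\mathcal{B}^2)$ with $\alpha\le\mu\le\beta$ and $\partial\mu(X)\le\varphi(X)$ for all $X\in\mathcal{B}$ if and only if $$\alpha(X\times X^c)-\beta(X^c\times X)\le\varphi(X)\qquad\text{for all }X\in\mathcal{B}.$$
   Context: $\mathcal{B}^2$ is the product Borel $\sigma$-algebra on $J\times J$, and $\mathcal{M}(\mathcal{B}^2)$ is the set of finite signed measures on $(J\times J,\mathcal{B}^2)$. The order on signed measures is setwise: $\mu\le\nu$ means $\nu-\mu$ is a (nonnegative) measure. $X^c=J\setminus X$. For $\mu\in\mathcal{M}(\mathcal{B}^2)$ the boundary is $\partial\mu(X)=\mu(X\times X^c)-\mu(X^c\times X)$ for $X\in\mathcal{B}$. A set function $\varphi\colon\mathcal{B}\to\mathbb{R}$ is submodular if $\varphi(A)+\varphi(B)\ge\varphi(A\cap B)+\varphi(A\cup B)$ for all $A,B\in\mathcal{B}$; it is continuous if $\varphi(A_n)\to\varphi(A)$ whenever $A,A_n\in\mathcal{B}$ and $\mathbf{1}_{A_n}\to\mathbf{1}_A$ pointwise on $J$. *)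

(* Defs.v *)
From HB Require Import structures.
From mathcomp Require Import all_boot all_order all_algebra.
From mathcomp Require Import all_classical all_reals all_analysis.
Set Implicit Arguments.
Unset Strict Implicit.
Unset Printing Implicit Defensive.
Import Order.TTheory GRing.Theory Num.Theory.
Import numFieldNormedType.Exports.
Local Open Scope classical_set_scope.
Local Open Scope ring_scope.

(* Completeness is spelled out as in [Uniform_isComplete], since [metricType]
   has no complete counterpart. *)
Definition complete_separable (R : realType) (P : metricType R) : Prop :=
  (forall F : set_system P, ProperFilter F -> cauchy F -> exists x : P, F --> x) /\
  (exists D : set P, countable D /\ dense D).

(* A measurable space is standard Borel if it is isomorphic to a Polish space
   with its Borel sets; [measurableType] is pointed, so J is nonempty. *)
Definition standard_borel (R : realType) (d : measure_display)
    (J : measurableType d) : Prop :=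
  exists (P : metricType R) (f : J -> P),
    [/\ complete_separable P, bijective f &
        forall A : set J, d.-measurable A <-> <<s @open P >> (f @` A)].

(* Finite signed measures are the library's charges. *)
Definition charge_le (R : realType) (d : measure_display)
    (T : measurableType d) (mu nu : {charge set T -> \bar R}) : Prop :=
  forall A : set T, measurable A -> (mu A <= nu A)%E.

Definition boundary (R : realType) (d : measure_display) (J : measurableType d)
    (mu : {charge set (J * J)%type -> \bar R}) (X : set J) : \bar R :=
  (mu (X `*` ~` X) - mu (~` X `*` X))%E.

(* Set functions on the sigma-algebra are total functions [set J -> R] whose
   values outside the measurable sets are never used. *)
Section set_functions.
Context (R : realType) (d : measure_display) (J : measurableType d).
Implicit Type phi : set J -> R.

Definition bounded_setfun phi : Prop :=
  exists M : R, forall A : set J, measurable A -> `|phi A| <= M.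

Definition submodular_setfun phi : Prop :=
  forall A B : set J, measurable A -> measurable B ->
    phi (A `&` B) + phi (A `|` B) <= phi A + phi B.

Definition continuous_setfun phi : Prop :=
  forall (A_ : nat -> set J) (A : set J),
    (forall n, measurable (A_ n)) -> measurable A ->
    (forall x : J, (\1_(A_ n) x : R) @[n --> \oo] --> (\1_A x : R)) ->
    phi (A_ n) @[n --> \oo] --> phi A.

End set_functions.

(* Main.v *)
Require Import Defs.
From HB Require Import structures.
From mathcomp Require Import all_boot all_order all_algebra.
From mathcomp Require Import all_classical all_reals all_analysis.
From mathcomp Require Import lra.
Import Order.TTheory GRing.Theory Num.Theory.
Import numFieldNormedType.Exports.
Local Open Scope classical_set_scope.
Local Open Scope ring_scope.

(** The proof reduces the statement to finite graphs, where it can be settled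
one edge at a time, and returns to J by compactness.

Finite case.  Let V be a finite set, a <= b real functions on V * V (the edges
of the complete directed graph), phi submodular on the subsets of V.  A flow m
with a <= m <= b has net outflow at least
  a(S * S^c) - b(S^c * S) =: least_flow a b S
from S, so least_flow a b <= phi is necessary for the net outflow of m to be
at most phi.  For sufficiency, replace the interval [a e, b e] of an edge e by
a single point x without violating least_flow a b <= phi.  Raising a e is
limited by the sets S that e leaves, lowering b e by the sets T that e enters.
These limits are compatible because least_flow is supermodular, with an excess
of at least b e - a e on a pair S, T that e crosses in opposite directions
([least_flow_crossing]); comparing with the submodularity of phi, the slacks of
S and T add up to at least b e - a e.  Once every edge is pinned, a = b = m,
and the inequality says that m is the desired flow
([finite_submodular_flow]).

Finitely many constraints.  Finitely many measurable subsets of J are unions of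
the blocks of a finite measurable partition.  The finite case, applied to the
masses that alpha and beta give to the products of two blocks, yields target
masses for these products; on each product a convex combination of alpha and
beta realizes the target ([finitely_many_constraints]).

Compactness.  Each value f(D) stays in the compact interval [alpha(D), beta(D)],
so the solutions for finite families of sets X converge setwise along an
ultrafilter on these families.  The limit f is finitely additive, lies between
alpha and beta, and satisfies all constraints ([finitely_additive_flow]).

Countable additivity.  A finitely additive f between two charges is countably
additive: the masses of the tails of a disjoint union tend to 0 for alpha and
for beta, hence for f ([charge_between]). *)

(** * Feasible flows in finite graphs *)

Section finite_flows.
Local Set Implicit Arguments.
Local Unset Strict Implicit.
Context {R : realDomainType} {V : finType}.
Implicit Types (a b m : V * V -> R) (e : V * V) (S T : {set V}).

Definition cut_term a b S e : R :=
  if e.1 \in S then (if e.2 \in S then 0 else a e)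
  else (if e.2 \in S then - b e else 0).

(** The infimum of the net outflow m(S * S^c) - m(S^c * S) over a <= m <= b.
It is a sum over all edges so that its supermodularity can be checked edge by
edge; [least_flowE] gives the usual form. *)
Definition least_flow a b S : R := \sum_e cut_term a b S e.

Lemma least_flowE a b S : least_flow a b S =
  \sum_(e | (e.1 \in S) && (e.2 \notin S)) a e -
  \sum_(e | (e.1 \notin S) && (e.2 \in S)) b e.
Proof.
rewrite big_mkcond [X in _ - X]big_mkcond -sumrB; apply: eq_bigr => e _.
by rewrite /cut_term; case: (e.1 \in S); case: (e.2 \in S); rewrite /=; lra.
Qed.

Lemma cut_term_supermodular a b S T e : a e <= b e ->
  cut_term a b S e + cut_term a b T e <=
  cut_term a b (S :&: T) e + cut_term a b (S :|: T) e.
Proof.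
rewrite /cut_term !inE.
by case: (e.1 \in S); case: (e.1 \in T); case: (e.2 \in S); case: (e.2 \in T);
  rewrite /=; lra.
Qed.

(** The edge e counts as a e for S and as - b e for T, but it lies inside the
union and misses the intersection, so it counts for neither of these: this is
where the excess b e - a e comes from. *)
Lemma least_flow_crossing a b S T e : (forall e', a e' <= b e') ->
  e.1 \in S -> e.2 \notin S -> e.1 \notin T -> e.2 \in T ->
  least_flow a b S + least_flow a b T + (b e - a e) <=
  least_flow a b (S :&: T) + least_flow a b (S :|: T).
Proof.
move=> ab eS1 eS2 eT1 eT2; rewrite /least_flow -!big_split /=.
rewrite (bigD1 e)//= [leRHS](bigD1 e)//= [leLHS]addrAC.
apply: lerD; last first.
  by apply: ler_sum => e' _; exact: cut_term_supermodular.
rewrite /cut_term !inE eS1 eT2 (negbTE eS2) (negbTE eT1) /=; lra.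
Qed.

Lemma least_flow_pin a b S e (x : R) :
  least_flow [eta a with e |-> x] [eta b with e |-> x] S =
  least_flow a b S +
    (if e.1 \in S then (if e.2 \in S then 0 else x - a e)
     else (if e.2 \in S then b e - x else 0)).
Proof.
rewrite /least_flow (bigD1 e)//= [in RHS](bigD1 e)//= addrAC; congr (_ + _).
  rewrite /cut_term /= eqxx.
  by case: (e.1 \in S); case: (e.2 \in S); lra.
by apply: eq_bigr => e' /negbTE e'e; rewrite /cut_term /= e'e.
Qed.

Context (phi : {set V} -> R)
  (phi_submod : forall S T, phi (S :&: T) + phi (S :|: T) <= phi S + phi T).

(** The value x is the smallest one that respects the lower bound a e and the
sets entered by e.  The sets left by e bound it from above, and they are
compatible with this choice because slacks of crossing sets add up to at least
b e - a e. *)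
Lemma pin_edge a b e : (forall e', a e' <= b e') ->
    (forall S, least_flow a b S <= phi S) ->
  exists x, [/\ a e <= x, x <= b e & forall S,
    least_flow [eta a with e |-> x] [eta b with e |-> x] S <= phi S].
Proof.
move=> ab abphi.
pose into T := (e.1 \notin T) && (e.2 \in T).
pose lower T := b e - (phi T - least_flow a b T).
pose x := \big[Num.max/a e]_(T | into T) lower T.
exists x; split.
- exact: bigmax_ge_id.
- apply: bigmax_le => // T _; rewrite /lower; have := abphi T; lra.
move=> S; rewrite least_flow_pin; have := abphi S.
case: ifPn => e1S; case: ifPn => e2S; rewrite ?addr0//.
- suff : x <= a e + (phi S - least_flow a b S) by lra.
  apply: bigmax_le => [|T /andP[e1T e2T]]; first by have := abphi S; lra.
  have := least_flow_crossing ab e1S e2S e1T e2T; have := phi_submod S T.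
  have := abphi (S :&: T); have := abphi (S :|: T); rewrite /lower; lra.
- suff : lower S <= x by rewrite /lower; lra.
  by apply: le_bigmax_cond; rewrite /into e1S e2S.
Qed.

Lemma pin_edges (s : seq (V * V)) a b : (forall e, a e <= b e) ->
    (forall S, least_flow a b S <= phi S) ->
  exists a' b', [/\ forall e, a e <= a' e <= b' e /\ b' e <= b e,
    {in s, a' =1 b'} & forall S, least_flow a' b' S <= phi S].
Proof.
move=> ab abphi; elim: s => [|e s [a' [b' [box eqs abphi']]]].
  by exists a, b; split=> // e; rewrite lexx ab.
have [|x [ax xb pinphi]] := @pin_edge a' b' e _ abphi'.
  by move=> e'; have [/andP[]] := box e'.
exists [eta a' with e |-> x], [eta b' with e |-> x]; split=> //.
- move=> e' /=; case: ifPn => [/eqP ->|_]; last exact: box.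
  by have [/andP[? _] ?] := box e; rewrite lexx !(le_trans _ ax, le_trans xb).
- move=> e'; rewrite inE /=; case: eqP => //= _; exact: eqs.
Qed.

Lemma finite_submodular_flow a b : (forall e, a e <= b e) ->
    (forall S, least_flow a b S <= phi S) ->
  exists m, (forall e, a e <= m e <= b e) /\
    forall S, least_flow m m S <= phi S.
Proof.
move=> ab abphi.
have [m [m' [box eqm mphi]]] := pin_edges (enum {: V * V}) ab abphi.
have mm' : m = m' by apply/funext => e; apply: eqm; rewrite mem_enum.
exists m; split=> [e|S]; last by rewrite {2}mm'.
by have [/andP[-> _]] := box e; rewrite -mm' => ->.
Qed.

End finite_flows.

(** * Finitely additive set functions and finite partitions *)

Section finitely_additive_functions.
Local Set Implicit Arguments.
Local Unset Strict Implicit.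
Context {R : realType} {d : measure_display} {T : measurableType d}.
Implicit Types (f p q : set T -> R) (D : set T).

Definition finitely_additive f := forall A B, measurable A -> measurable B ->
  A `&` B = set0 -> f (A `|` B) = f A + f B.

Definition between p q f := forall D, measurable D -> p D <= f D <= q D.

Lemma finitely_additive0 f : finitely_additive f -> f set0 = 0.
Proof.
move=> fadd; have := fadd set0 set0 measurable0 measurable0 (setI0 _).
by rewrite setU0 => /eqP; rewrite -subr_eq subrr eq_sym => /eqP.
Qed.

(** The fibres of g are the blocks of a finite measurable partition of T. *)
Section finite_partition.
Context {E : finType} {g : T -> E}
  (mg : forall e, measurable (g @^-1` [set e])).

Lemma measurable_preimage_finite (P : pred E) : measurable [set x | P (g x)].
Proof.
rewrite [X in measurable X](_ : _ =
    \bigcup_(e in [set e | P e]) g @^-1` [set e]).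
  by apply: fin_bigcup_measurable => // e _; exact: mg.
by apply/seteqP; split=> [x Px|x [e Pe /= gx]]; [exists (g x)|rewrite /= gx].
Qed.

Lemma finitely_additive_fibres f (P : pred E) D : finitely_additive f ->
    measurable D ->
  f (D `&` [set x | P (g x)]) = \sum_(e | P e) f (D `&` g @^-1` [set e]).
Proof.
move=> fadd mD; rewrite -big_filter.
have -> : [set x | P (g x)] = [set x | g x \in [seq e <- index_enum E | P e]].
  by apply/seteqP; split=> x /=; rewrite mem_filter mem_index_enum andbT.
have := filter_uniq P (index_enum_uniq E).
elim: [seq e <- _ | P e] => [_|e s IH /= /andP[es us]].
  rewrite big_nil (_ : _ `&` _ = set0) ?finitely_additive0//.
  by rewrite -subset0 => x [].
rewrite big_cons -IH// -fadd.
- rewrite -setIUr; congr (f (_ `&` _)).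
  apply/seteqP; split=> x /=; rewrite inE.
    by case/predU1P; [left|right].
  by case=> [->|->]; rewrite ?eqxx ?orbT.
- by apply: measurableI => //; exact: mg.
- by apply: measurableI => //; exact: (measurable_preimage_finite (mem s)).
- rewrite -subset0 => x [[_ /= gx] [_ /=]].
  by rewrite gx (negbTE es).
Qed.

Lemma finitely_additive_sum_fibres f D : finitely_additive f -> measurable D ->
  f D = \sum_e f (D `&` g @^-1` [set e]).
Proof.
move=> fadd mD; rewrite -(@finitely_additive_fibres f xpredT)//.
by congr f; rewrite -[LHS]setIT; congr setI; apply/seteqP.
Qed.

(** On each fibre, f is the convex combination of p and q with the weight that
gives the fibre its prescribed mass. *)
Lemma interpolate_fibres p q (m : E -> R) :
    finitely_additive p -> finitely_additive q ->
    (forall D, measurable D -> p D <= q D) ->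
    (forall e, p (g @^-1` [set e]) <= m e <= q (g @^-1` [set e])) ->
  exists f, [/\ finitely_additive f, between p q f &
    forall e, f (g @^-1` [set e]) = m e].
Proof.
move=> padd qadd pq pmq.
pose cell e := g @^-1` [set e].
pose w e := (m e - p (cell e)) / (q (cell e) - p (cell e)).
(* On a fibre where p and q agree, the weight is 0 / 0 = 0, which is harmless:
   there m e is squeezed between equal numbers. *)
have w01 e : 0 <= w e <= 1.
  have /andP[pm mq] := pmq e.
  have := pq (cell e) (mg e); rewrite le_eqVlt => /predU1P[eqpq|ltpq].
    by rewrite /w eqpq subrr invr0 mulr0 lexx ler01.
  rewrite divr_ge0 ?subr_ge0 ?(ltW ltpq)//= ler_pdivrMr ?subr_gt0//.
  by rewrite mul1r lerD2r.
pose h e D := p D + w e * (q D - p D).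
have hadd e : finitely_additive (h e).
  by move=> A B mA mB AB; rewrite /h padd// qadd//; lra.
exists (fun D => \sum_e h e (D `&` cell e)); split.
- move=> A B mA mB AB; rewrite -big_split/=; apply: eq_bigr => e _.
  rewrite setIUl hadd//.
  - by apply: measurableI => //; exact: mg.
  - by apply: measurableI => //; exact: mg.
  - by rewrite setIACA AB set0I.
- move=> D mD; rewrite (finitely_additive_sum_fibres padd mD).
  rewrite (finitely_additive_sum_fibres qadd mD).
  apply/andP; split; apply: ler_sum => e _;
    have := pq _ (measurableI _ _ mD (mg e)); have /andP[] := w01 e;
    rewrite /h -/(cell e); nra.
- move=> e; rewrite (bigD1 e)//= big1 ?addr0.
    rewrite setIid /h /w.
    have /andP[pm mq] := pmq e.
    have := pq (cell e) (mg e); rewrite le_eqVlt => /predU1P[eqpq|ltpq].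
      rewrite -/(cell e) in pm mq *; rewrite eqpq subrr mulr0 addr0.
      by apply/le_anti; rewrite mq -eqpq pm.
    by rewrite divfK ?subr_eq0 ?gt_eqF// addrC subrK.
  move=> e' e'e; rewrite (_ : _ `&` _ = set0) ?finitely_additive0//.
  rewrite -subset0 => x [/= gx gx'].
  by move: e'e; rewrite -gx' gx eqxx.
Qed.

End finite_partition.
End finitely_additive_functions.

(** * Limits along an ultrafilter *)

Section ultralimit.
Local Set Implicit Arguments.
Local Unset Strict Implicit.

Lemma ultra_cvg_bounded {R : realType} {I : Type} (U : set_system I)
    (h : I -> R) (a b : R) : UltraFilter U ->
  U [set i | a <= h i <= b] -> exists l : R, h i @[i --> U] --> l.
Proof.
move=> UU Uab; have hUU : UltraFilter (h @ U).
  split; first exact: fmap_proper_filter.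
  move=> G PG hUG; apply/seteqP; split=> // A GA.
  have [//|UnA] := in_ultra_setVsetC (h @^-1` A) UU.
  have : G (A `&` ~` A) by apply: filterI => //; exact: hUG.
  by rewrite setICr => /filter_not_empty.
have := @segment_compact R a b; rewrite compact_ultra => /(_ _ hUU)[|l [_ hl]].
  suff : U (h @^-1` `[a, b]) by [].
  by apply: filterS Uab => i hi; rewrite /= in_itv.
by exists l.
Qed.

(** The directed set of finite families under inclusion, as a filter: what holds
near it holds for all sufficiently large families. *)
Lemma finite_families_filter (T : choiceType) :
  ProperFilter (filter_from setT (fun F : seq T =>
    [set F' : seq T | {subset F <= F'}])).
Proof.
apply: filter_from_proper; last by move=> F _; exists F.
apply: filter_from_filter; first by exists [::].
move=> F F' _ _; exists (F ++ F') => // G FG.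
by split=> x xF; apply: FG; rewrite mem_cat xF ?orbT.
Qed.

End ultralimit.

(** * Finitely additive flows *)

Section finitely_additive_flows.
Local Set Implicit Arguments.
Local Unset Strict Implicit.
Context {R : realType} {d : measure_display} {J : measurableType d}.

(** The label s x records which members of F contain x; its fibres are the atoms
of the algebra generated by F. *)
Lemma finite_family_partition (F : seq (set J)) :
    (forall X, X \in F -> measurable X) ->
  exists (V : finType) (s : J -> V),
    (forall v, measurable (s @^-1` [set v])) /\
    forall X, X \in F -> exists S : {set V}, X = [set x | s x \in S].
Proof.
move=> mF; pose V : finType := {ffun 'I_(size F) -> bool}.
pose s x : V := [ffun i : 'I_(size F) => `[< nth set0 F i x >]].
exists V, s; split=> [v|X XF].
  pose G (i : 'I_(size F)) :=
    if v i then nth set0 F i else ~` nth set0 F i.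
  rewrite (_ : _ @^-1` _ = \bigcap_(i in setT) G i).
    apply: fin_bigcap_measurable => // i _; rewrite /G.
    have mFi : measurable (nth set0 F i) by apply/mF/mem_nth.
    by case: ifP => // _; exact: measurableC.
  apply/seteqP; split=> x /=.
    move=> xv i _; rewrite /G -xv ffunE.
    by case: asboolP.
  move=> Gx; apply/ffunP => i; rewrite ffunE; have := Gx i I; rewrite /G.
  by case: (v i) => ?; [apply/asboolT|apply/asboolF].
have iF : (index X F < size F)%N by rewrite index_mem.
exists (finset (fun v : V => v (Ordinal iF))).
apply/seteqP; split=> x /=; rewrite inE ffunE /= nth_index//.
  by move=> ?; apply/asboolT.
by move/asboolP.
Qed.

Context {p q : set (J * J)%type -> R} {phi : set J -> R}
  (padd : finitely_additive p) (qadd : finitely_additive q)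
  (pq : forall D, measurable D -> p D <= q D)
  (phi_submod : submodular_setfun phi)
  (pqphi : forall X, measurable X ->
     p (X `*` ~` X) - q (~` X `*` X) <= phi X).

(** A family F only tests unions of blocks of its partition, so the constraints
for F are those of a flow on the finite graph whose vertices are the blocks.
Non-measurable members of F are tolerated so that the families can range over
the whole type [seq (set J)] when a limit over them is taken. *)
Lemma finitely_many_constraints (F : seq (set J)) :
  exists f, [/\ finitely_additive f, between p q f &
    forall X, X \in F -> measurable X ->
      f (X `*` ~` X) - f (~` X `*` X) <= phi X].
Proof.
wlog mF : F / forall X, X \in F -> measurable X.
  move=> /(_ [seq X <- F | `[< measurable X >]])[].
    by move=> X; rewrite mem_filter => /andP[/asboolP].
  move=> f [fadd pfq fphi]; exists f; split=> // X XF mX.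
  by apply: fphi => //; rewrite mem_filter XF andbT; apply/asboolT.
have [V [s [ms FS]]] := finite_family_partition mF.
pose g (z : J * J) := (s z.1, s z.2).
have mg e : measurable (g @^-1` [set e]).
  rewrite (_ : _ @^-1` _ = (s @^-1` [set e.1]) `*` (s @^-1` [set e.2])).
    exact: measurableX.
  by case: e => u v; apply/seteqP; split=> [z [<- <-]|z [/= <- <-]].
pose union (S : {set V}) := [set x | s x \in S].
have munion S : measurable (union S).
  exact: (measurable_preimage_finite ms (mem S)).
pose weight (f : set (J * J)%type -> R) e := f (g @^-1` [set e]).
have cutE f f' (S : {set V}) : finitely_additive f -> finitely_additive f' ->
    f (union S `*` ~` union S) - f' (~` union S `*` union S) =
    least_flow (weight f) (weight f') S.
  move=> fadd f'add; rewrite least_flowE; congr (_ - _).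
    under eq_bigr do rewrite /weight -[_ @^-1` _]setTI.
    rewrite -(finitely_additive_fibres mg)// setTI; congr f.
    by apply/seteqP; split=> z /= => [[Sz1 /negP Sz2]|/andP[Sz1 /negP Sz2]];
      [exact/andP|split].
  under eq_bigr do rewrite /weight -[_ @^-1` _]setTI.
  rewrite -(finitely_additive_fibres mg)// setTI; congr f'.
  by apply/seteqP; split=> z /= => [[/negP Sz1 Sz2]|/andP[/negP Sz1 Sz2]];
    [exact/andP|split].
have [| | |m [pmq mphi]] := @finite_submodular_flow R V (phi \o union) _
    (weight p) (weight q).
- move=> S T /=; have := phi_submod (munion S) (munion T).
  congr (phi _ + phi _ <= _); apply/seteqP; split=> x;
    rewrite /union /= inE.
  + by case=> -> ->.
  + by case/andP.
  + by case=> ->; rewrite ?orbT.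
  + by case/orP; [left|right].
- by move=> e; exact: pq.
- by move=> S; rewrite -cutE//; exact: pqphi.
have [f [fadd pfq fm]] := interpolate_fibres mg padd qadd pq pmq.
exists f; split=> // X /FS[S ->] _; rewrite -/(union S) cutE//.
by rewrite (_ : weight f = m)//; apply/funext.
Qed.

(** The choice of a solution for each finite family converges setwise along an
ultrafilter containing, for each X, the families that contain X. *)
Lemma finitely_additive_flow : exists f, [/\ finitely_additive f, between p q f &
  forall X, measurable X -> f (X `*` ~` X) - f (~` X `*` X) <= phi X].
Proof.
have [f_ f_P] := choice finitely_many_constraints.
have [U [UU famU]] := ultraFilterLemma (finite_families_filter (set J)).
pose f D := lim (f_ F D @[F --> U]).
have fcvg D : measurable D -> f_ F D @[F --> U] --> f D.
  move=> mD; have [l fl] : exists l : R, f_ F D @[F --> U] --> l.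
    apply: (@ultra_cvg_bounded _ _ U _ (p D) (q D)).
    by apply: filterE => F; have [_ /(_ _ mD)] := f_P F.
  by apply/cvg_ex; exists l.
exists f; split.
- move=> A B mA mB AB; apply: (@cvg_unique _ _ (f_ F (A `|` B) @[F --> U])) => //.
    by apply: fcvg; exact: measurableU.
  rewrite (_ : (fun F => _) = (fun F => f_ F A + f_ F B)).
    by apply: cvgD; exact: fcvg.
  by apply/funext => F; have [-> ] := f_P F.
- move=> D mD; apply/andP; split.
    apply: (cvgr_to_ge (fcvg D mD)).
    by apply: nearW => F; have [_ /(_ _ mD)/andP[]] := f_P F.
  apply: (cvgr_to_le (fcvg D mD)).
  by apply: nearW => F; have [_ /(_ _ mD)/andP[]] := f_P F.
- move=> X mX; have mXC := measurableC mX.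
  have cvgX : f_ F (X `*` ~` X) - f_ F (~` X `*` X) @[F --> U] -->
      f (X `*` ~` X) - f (~` X `*` X).
    by apply: cvgB; apply: fcvg; exact: measurableX.
  apply: (cvgr_to_le cvgX); apply: famU.
  exists [:: X] => // F /(_ X); rewrite mem_head => /(_ isT) XF.
  by have [_ _ /(_ X XF mX)] := f_P F.
Qed.

End finitely_additive_flows.

(** * Finitely additive functions between charges *)

Section sandwiched_additive_functions.
Local Set Implicit Arguments.
Local Unset Strict Implicit.
Context {R : realType} {d : measure_display} {T : measurableType d}.

Lemma fine_chargeK (nu : {charge set T -> \bar R}) D : measurable D ->
  (fine (nu D))%:E = nu D.
Proof. by move=> mD; rewrite fineK// fin_num_measure. Qed.

Lemma finitely_additive_charge (nu : {charge set T -> \bar R}) :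
  finitely_additive (fine \o nu).
Proof.
by move=> A B mA mB AB /=; rewrite chargeU// fineD ?fin_num_measure.
Qed.

Lemma finitely_additive_bigcup f (D : nat -> set T) n :
    finitely_additive f -> (forall i, measurable (D i)) -> trivIset setT D ->
  f (\bigcup_i D i) =
    \sum_(0 <= i < n) f (D i) + f (\bigcup_(i in [set i | (n <= i)%N]) D i) :> R.
Proof.
move=> fadd mD tD; elim: n => [|n IH].
  by rewrite big_nil add0r; congr (f _); apply: eq_bigcupl; split.
rewrite IH big_nat_recr//= -addrA; congr (_ + _); rewrite -fadd//.
- congr f; apply/seteqP; split=> [x [i /=]|x [Dx|[i /= ni Dx]]].
  + rewrite leq_eqVlt => /predU1P[<-|ni] Dx; first by left.
    by right; exists i.
  + by exists n => /=.
  + by exists i => //=; exact: ltnW.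
- exact: bigcup_measurable.
- rewrite -subset0 => x [Dnx [i /= ni Dix]].
  have ein : i = n by apply: tD => //; exists x.
  by rewrite ein ltnn in ni.
Qed.

Lemma charge_tail_cvg0 (nu : {charge set T -> \bar R}) (D : nat -> set T) :
    (forall i, measurable (D i)) -> trivIset setT D ->
  fine (nu (\bigcup_(i in [set i | (n <= i)%N]) D i)) @[n --> \oo] --> (0 : R).
Proof.
move=> mD tD; have mU := bigcup_measurable (fun i (_ : setT i) => mD i).
pose s n := \sum_(0 <= i < n) fine (nu (D i)).
have sE n : (s n)%:E = (\sum_(0 <= i < n) nu (D i))%E.
  by rewrite /s -sumEFin; apply: eq_bigr => i _; rewrite fine_chargeK.
have scvg : s n @[n --> \oo] --> fine (nu (\bigcup_i D i)).
  suff : (s n)%:E @[n --> \oo] --> (fine (nu (\bigcup_i D i)))%:E.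
    by move/fine_cvg.
  rewrite fine_chargeK//; under eq_fun do rewrite sE.
  exact: charge_semi_sigma_additive.
rewrite [X in X @ _ --> _](_ : _ = fun n => fine (nu (\bigcup_i D i)) - s n).
  by rewrite -(subrr (fine (nu (\bigcup_i D i)))); apply: cvgB => //; exact: cvg_cst.
apply/funext => n.
have /= -> := finitely_additive_bigcup n (finitely_additive_charge nu) mD tD.
by rewrite addrC addKr.
Qed.

(** The value of f on the tail of a disjoint union is squeezed between two null
sequences. *)
Lemma charge_between (alpha beta : {charge set T -> \bar R}) f :
    finitely_additive f -> between (fine \o alpha) (fine \o beta) f ->
  exists mu : {charge set T -> \bar R},
    forall D, measurable D -> mu D = (f D)%:E.
Proof.
move=> fadd fab; pose mu D := (f D)%:E.
have mu0 : mu set0 = 0%E by rewrite /mu finitely_additive0.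
have mufin D : measurable D -> mu D \is a fin_num by [].
have musigma : semi_sigma_additive mu.
  move=> D mD tD mU.
  pose tail n := \bigcup_(i in [set i | (n <= i)%N]) D i.
  have mtail n : measurable (tail n) by exact: bigcup_measurable.
  have ftail0 : f (tail n) @[n --> \oo] --> 0.
    apply: (@squeeze_cvgr _ _ _ _ (fun n => fine (alpha (tail n)))
        (fun n => fine (beta (tail n)))).
    - by apply: nearW => n; exact: fab.
    - exact: charge_tail_cvg0.
    - exact: charge_tail_cvg0.
  rewrite (_ : (fun n => _) =
      EFin \o (fun n => f (\bigcup_i D i) - f (tail n))).
    apply: cvg_EFin; first exact: nearW.
    rewrite -[X in _ --> X]subr0; apply: cvgB => //; exact: cvg_cst.
  apply/funext => n /=.
  by rewrite (finitely_additive_bigcup n fadd)// addrK sumEFin.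
pose muM := isCharge.Build _ T R mu mu0 mufin musigma.
pose muC : {charge set T -> \bar R} := HB.pack mu muM.
by exists muC.
Qed.

End sandwiched_additive_functions.

Theorem theorem3p6 (R : realType) (d : measure_display) (J : measurableType d)
    (hJ : standard_borel R J)
    (alpha beta : {charge set (J * J)%type -> \bar R})
    (hab : charge_le alpha beta)
    (phi : set J -> R)
    (phi_bounded : bounded_setfun phi)
    (phi_continuous : continuous_setfun phi)
    (phi_submodular : submodular_setfun phi)
    (phi0 : phi set0 = 0) (phiT : phi setT = 0) :
  (exists mu : {charge set (J * J)%type -> \bar R},
     [/\ charge_le alpha mu, charge_le mu beta &
         forall X : set J, measurable X -> (boundary mu X <= (phi X)%:E)%E])
  <->
  (forall X : set J, measurable X ->
     (alpha (X `*` ~` X) - beta (~` X `*` X) <= (phi X)%:E)%E).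
Proof.
split=> [[mu [amu mub muphi]] X mX|abphi].
  have mXC := measurableC mX; apply: le_trans (muphi X mX).
  by apply: leeB; [apply: amu|apply: mub]; exact: measurableX.
have ab D : measurable D -> fine (alpha D) <= fine (beta D).
  by move=> mD; rewrite fine_le ?fin_num_measure//; exact: hab.
have [X mX|f [fadd fab fphi]] := finitely_additive_flow
    (finitely_additive_charge alpha) (finitely_additive_charge beta)
    ab phi_submodular.
  have mXC := measurableC mX.
  rewrite -lee_fin EFinB /= EFinN (fine_chargeK alpha (measurableX mX mXC)).
  by rewrite (fine_chargeK beta (measurableX mXC mX)) abphi.
have [mu muE] := charge_between fadd fab; exists mu; split.
- move=> D mD; rewrite muE// -fine_chargeK// lee_fin.
  by have /andP[] := fab D mD.
- move=> D mD; rewrite muE// -[leRHS]fine_chargeK// lee_fin.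
  by have /andP[] := fab D mD.
- move=> X mX; have mXC := measurableC mX.
  rewrite /boundary (muE _ (measurableX mX mXC)) (muE _ (measurableX mXC mX)).
  by rewrite -EFinB lee_fin fphi.
Qed.
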